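(* Let $n,i,\ell\in\mathbb{Z}$ with $-1\le\ell\le n-3$ and $1\le i\le\frac{n-1-\ell}{2}$. Then every graph $G$ in $\mathcal{G}_n^{\ell}(i)$: is not Hamiltonian when $\ell=0$; is not traceable when $\ell=-1$; is not Hamiltonian-connected when $\ell=1$; is not $k$-edge Hamiltonian when $\ell=k$ for some $k\in\{1,\ldots,n-3\}$; and is not $k$-Hamiltonian when $\ell=k$ for some $k\in\{1,\ldots,n-3\}$.
   Context: All graphs are finite and simple. $K_m$ is the complete graph and $I_m$ the edgeless graph on $m$ vertices; $\cup$ denotes disjoint union, and $A+B$ denotes the join (disjoint union of $A$ and $B$ together with all edges between them). For integers $n,i,\ell$ with $-1\le\ell\le n-3$ and $1\le i\le\frac{n-1-\ell}{2}$, define $G_n^{\ell}(i)=K_{i+\ell}+(I_i\cup K_{n-2i-\ell})$; when $i+\ell=0$ this is $I_1\cup K_{n-1}$. Let $\mathcal{G}_n^{\ell}(i)$ be the set of all spanning subgraphs of $G_n^{\ell}(i)$ in which the only edges allowed to be missing are edges of the $K_{n-2i-\ell}$. A graph is Hamiltonian if it has a Hamilton cycle (spanning cycle), traceable if it has a Hamilton path (spanning path), Hamiltonian-connected if it has a Hamilton path between every pair of distinct vertices. For $k\in\{0,\ldots,n-3\}$, an $n$-vertex graph $G$ is $k$-edge Hamiltonian if every linear forest in $G$ (disjoint union of paths) with at most $k$ edges is contained in a Hamilton cycle of $G$; it is $k$-Hamiltonian if the removal of any set of at most $k$ vertices results in a Hamiltonian graph. *)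

(* Defs.v *)
From HB Require Import structures.
From mathcomp Require Import all_boot all_order all_algebra.

Set Implicit Arguments.
Unset Strict Implicit.
Unset Printing Implicit Defensive.

Import Order.TTheory GRing.Theory Num.Theory.

Record sgraph (V : finType) := SGraph {
  edge :> rel V;
  edge_sym : symmetric edge;
  edge_irr : irreflexive edge }.

Section Constructions.
Variables U V : finType.

Definition complete_edge : rel V := [rel x y | x != y].

Lemma complete_sym : symmetric complete_edge.
Proof. by move=> x y; rewrite /complete_edge /= eq_sym. Qed.

Lemma complete_irr : irreflexive complete_edge.
Proof. by move=> x; rewrite /complete_edge /= eqxx. Qed.

Definition complete : sgraph V := SGraph complete_sym complete_irr.

Definition edgeless : sgraph V :=
  @SGraph V [rel x y | false] (fun _ _ => erefl) (fun _ => erefl).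

Variables (A : sgraph U) (B : sgraph V).

Definition union_edge : rel (U + V) := fun x y =>
  match x, y with
  | inl a, inl a' => A a a'
  | inr b, inr b' => B b b'
  | _, _ => false
  end.

Lemma union_sym : symmetric union_edge.
Proof. by move=> [a|b] [a'|b'] //=; rewrite edge_sym. Qed.

Lemma union_irr : irreflexive union_edge.
Proof. by move=> [a|b] /=; rewrite edge_irr. Qed.

Definition gunion : sgraph (U + V)%type := SGraph union_sym union_irr.

Definition join_edge : rel (U + V) := fun x y =>
  match x, y with
  | inl a, inl a' => A a a'
  | inr b, inr b' => B b b'
  | _, _ => true
  end.

Lemma join_sym : symmetric join_edge.
Proof. by move=> [a|b] [a'|b'] //=; rewrite edge_sym. Qed.

Lemma join_irr : irreflexive join_edge.
Proof. by move=> [a|b] /=; rewrite edge_irr. Qed.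

Definition gjoin : sgraph (U + V)%type := SGraph join_sym join_irr.

End Constructions.

Section Deletion.
Variables (V : finType) (G : sgraph V) (S : {set V}).

Definition del_edge : rel {x : V | x \notin S} := [rel x y | G (val x) (val y)].

Lemma del_sym : symmetric del_edge.
Proof. by move=> x y; rewrite /del_edge /= edge_sym. Qed.

Lemma del_irr : irreflexive del_edge.
Proof. by move=> x; rewrite /del_edge /= edge_irr. Qed.

Definition del_verts : sgraph {x : V | x \notin S} := SGraph del_sym del_irr.

End Deletion.

Section Hamiltonicity.
Variables (V : finType) (G : sgraph V).

(* [ucycle] also accepts the empty sequence and the two ends of an edge, which
   are not cycles of a simple graph; hence the bound on the size. *)
Definition hamilton_cycle (c : seq V) : Prop :=
  [/\ 3 <= size c, ucycle G c & forall x, x \in c].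

Definition hamilton_path (p : seq V) : Prop :=
  [/\ uniq p, sorted G p & forall x, x \in p].

Definition hamiltonian : Prop := exists c, hamilton_cycle c.

Definition traceable : Prop := exists p, hamilton_path p.

Definition hamiltonian_connected : Prop :=
  forall x y, x != y -> exists p, hamilton_path (x :: p) /\ last x p = y.

(* A linear forest is given by the vertex sequences of its paths; a path with
   one vertex is allowed. *)
Definition linear_forest (F : seq (seq V)) : Prop :=
  [/\ [::] \notin F, uniq (flatten F) & all (sorted G) F].

Definition forest_size (F : seq (seq V)) : nat := \sum_(p <- F) (size p).-1.

Definition cycle_adj (c : seq V) : rel V :=
  [rel x y | [&& x \in c, y \in c & (next c x == y) || (next c y == x)]].

(* For a spanning cycle [c], containment of a subgraph is containment of its
   edges. *)
Definition forest_in_cycle (F : seq (seq V)) (c : seq V) : Prop :=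
  all (sorted (cycle_adj c)) F.

Definition k_edge_hamiltonian (k : nat) : Prop :=
  forall F, linear_forest F -> forest_size F <= k ->
  exists c, hamilton_cycle c /\ forest_in_cycle F c.

End Hamiltonicity.

Definition k_hamiltonian (V : finType) (G : sgraph V) (k : nat) : Prop :=
  forall S : {set V}, #|S| <= k -> hamiltonian (del_verts G S).

Definition spanning_subgraph (V : finType) (H G : sgraph V) : Prop :=
  subrel H G.

Local Open Scope ring_scope.

(* The absolute values are harmless: [i + l], [i] and [n - 2 i - l] are
   nonnegative when [-1 <= l], [1 <= i] and [2 i <= n - 1 - l]. *)
Definition Gvertex (n l i : int) : finType :=
  ('I_(absz (i + l)%R) + ('I_(absz i) + 'I_(absz (n - 2 * i - l)%R)))%type.

(* For [i + l = 0] the first summand is empty, leaving I_1 and K_(n - 1). *)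
Definition Ggraph (n l i : int) : sgraph (Gvertex n l i) :=
  gjoin (complete 'I_(absz (i + l)%R))
        (gunion (edgeless 'I_(absz i)) (complete 'I_(absz (n - 2 * i - l)%R))).

Definition Gfamily (n l i : int) (H : sgraph (Gvertex n l i)) : Prop :=
  spanning_subgraph H (Ggraph n l i) /\
  forall x y, Ggraph n l i x y -> ~~ H x y ->
    exists u v : 'I_(absz (n - 2 * i - l)%R), x = inr (inr u) /\ y = inr (inr v).

(* Main.v *)
(* Deleting the i + l vertices of A = K_(i+l) from G leaves the i vertices of
   B = I_i isolated, and the remaining vertices are nonadjacent to B.  Orient a
   spanning cyclic order and let f be the successor map.  Then f^-1(B), one
   vertex where the order enters the complement of A and B, and the x in A with
   f(x) in A are pairwise disjoint; up to the steps that are not edges of G all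
   of them lie in A.  Hence |B| + 1 + #(steps inside A) <= |A| + #(non-edges).
   A Hamilton path closes up to a cyclic order with one non-edge, a Hamilton
   path between two vertices of A to one with a step inside A, and a Hamilton
   cycle through a path with k edges in A has k steps inside A. *)
Require Import Defs.
From HB Require Import structures.
From mathcomp Require Import all_boot all_order all_algebra.
From mathcomp Require Import zify.

Set Implicit Arguments.
Unset Strict Implicit.
Unset Printing Implicit Defensive.

Import Order.TTheory GRing.Theory Num.Theory.

(** * Counting steps of a spanning cyclic order *)

Section SpanningOrder.
Variables (V : finType) (c : seq V).
Hypotheses (Uc : uniq c) (cV : forall x, x \in c).

Lemma next_inj : injective (next c).
Proof. exact: can_inj (prev_next Uc). Qed.

(** A set closed under [next c] contains the orbit of each of its points, and that orbit is all of
    [V]. *)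
Lemma exists_next_exit (C : {set V}) :
  C != set0 -> C != setT -> exists2 x, x \in C & next c x \notin C.
Proof.
move=> /set0Pn[x xC] CT; apply/exists_inP; apply: contraR CT => exit.
apply/eqP/setP => y; rewrite inE.
have xy : fconnect (next c) x y.
  by rewrite (fconnect_cycle (cycle_next Uc) (cV x)).
rewrite -(iter_findex xy); elim: (findex _ _ _) => [//|n IHn] /=.
by move/exists_inPn: exit => /(_ _ IHn); rewrite negbK.
Qed.

(** The order need not follow [e]: steps off [e] are paid for on the right, but only those starting
    outside [A], as the others are covered by [#|A|]. *)
Lemma card_isolated_side (e : rel V) (A B : {set V}) :
  symmetric e -> [disjoint A & B] -> A :|: B != set0 -> A :|: B != setT ->
  (forall x y, x \in B -> e x y -> y \in A) ->
  #|B|.+1 + #|[set x in A | next c x \in A]|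
    <= #|A| + #|[set x | ~~ e x (next c x)] :\: A|.
Proof.
move=> esym dAB AB0 ABT eB.
have [z zAB] := exists_next_exit AB0 ABT.
rewrite inE negb_or => /andP[zA zB].
set I := [set x in A | _]; set D := _ :\: A.
set P := next c @^-1: B.
have cP : #|P| = #|B| by apply: on_card_preimset; apply: onW_bij;
  exact: injF_bij next_inj.
(* The three kinds of points are told apart by their images under [next c]: outside [A :|: B], in
   [B], in [A]. *)
have dPI : [disjoint z |: P & I].
  rewrite disjoints_subset; apply/subsetP => x; rewrite !inE.
  case/orP => [/eqP ->|xB]; first by rewrite (negPf zA) andbF.
  by rewrite (disjointFl dAB xB) andbF.
have -> : #|B|.+1 + #|I| = #|(z |: P) :|: I|.
  move: (leq_card_setU (z |: P) I) => /leqifP; rewrite dPI => /eqP ->.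
  by rewrite cardsU1 inE zB cP.
apply: leq_trans (leq_card_setU A D); apply: subset_leq_card.
apply/subsetP => x; rewrite !inE; case: (boolP (x \in A)) => //= xA.
(* From [x] outside [A], the step either leaves [B] for a vertex not in [A] or enters [B]; neither
   can be an edge. *)
rewrite orbF; case/orP => [/eqP xz|xB].
  have zB' : z \in B by move: zAB; rewrite inE -xz (negPf xA).
  by apply: contra zA => ez; apply: eB zB' _; rewrite -xz.
by apply: contra xA => ex; apply: eB xB _; rewrite esym.
Qed.

(** Turning back after [y] would give [y] a second predecessor, so by injectivity the path would
    revisit [x]. *)
Lemma path_cycle_adj_next x y p : uniq [:: x, y & p] ->
  path (cycle_adj c) y p -> next c x = y -> fpath (next c) x (y :: p).
Proof.
elim: p x y => [|z p IHp] x y; first by move=> _ _ /= ->; rewrite eqxx.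
move=> Uxyzp /= /andP[/and3P[_ _ yz] zp] xy; rewrite xy eqxx /=.
apply: IHp => //; first by case/andP: Uxyzp.
case/orP: yz => /eqP // zy; move: Uxyzp.
have -> : z = x by apply: next_inj; rewrite zy.
by rewrite /= !inE eqxx orbT.
Qed.

(** Here a turn would make the vertex after [y] its successor, hence equal to [x]. *)
Lemma path_cycle_adj_prev x y p : uniq [:: x, y & p] ->
  path (cycle_adj c) y p -> next c y = x ->
  path [rel u v | next c v == u] x (y :: p).
Proof.
elim: p x y => [|z p IHp] x y; first by move=> _ _ /= ->; rewrite eqxx.
move=> Uxyzp /= /andP[/and3P[_ _ yz] zp] xy; rewrite xy eqxx /=.
apply: IHp => //; first by case/andP: Uxyzp.
case/orP: yz => /eqP // yz; move: Uxyzp.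
by rewrite -xy yz /= !inE eqxx orbT.
Qed.

Lemma fpath_belast (f : V -> V) x p (A : {set V}) : fpath f x p ->
  {subset x :: p <= A} -> {subset belast x p <= [set v in A | f v \in A]}.
Proof.
elim: p x => [//|y p IHp] x /= /andP[/eqP fx yp] sA v /=.
rewrite !inE => /predU1P[->|vp].
  by rewrite fx !sA ?inE ?eqxx ?orbT.
have sA' : {subset y :: p <= A} by move=> u up; apply: sA; apply: mem_behead.
by have := IHp _ yp sA' _ vp; rewrite inE.
Qed.

Lemma path_pred_behead (f : V -> V) x p (A : {set V}) :
  path [rel u v | f v == u] x p ->
  {subset x :: p <= A} -> {subset p <= [set v in A | f v \in A]}.
Proof.
elim: p x => [//|y p IHp] x /= /andP[/eqP fy yp] sA v.
rewrite !inE => /predU1P[->|vp].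
  by rewrite fy !sA ?inE ?eqxx ?orbT.
have sA' : {subset y :: p <= A} by move=> u up; apply: sA; apply: mem_behead.
by have := IHp _ yp sA' _ vp; rewrite inE.
Qed.

(* Being injective on a repetition-free path, the successor map traverses all
   its edges in the same direction. *)
Lemma card_next_path (A : {set V}) x p : uniq (x :: p) ->
  path (cycle_adj c) x p -> {subset x :: p <= A} ->
  size p <= #|[set v in A | next c v \in A]|.
Proof.
case: p => [//|y p] Uxp /= /andP[/and3P[_ _ xy] yp] sA.
have cardT s : uniq s -> {subset s <= [set v in A | next c v \in A]} ->
    size s <= #|[set v in A | next c v \in A]|.
  by move=> Us sI; rewrite -(card_uniqP Us); apply/subset_leq_card/subsetP.
(* Forwards, every vertex but the last starts a step inside [A]; backwards, every vertex but the
   first does. *)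
case/orP: xy => /eqP xy.
  have := cardT (belast x (y :: p)); rewrite size_belast; apply.
    by move: Uxp; rewrite lastI rcons_uniq => /andP[].
  exact: fpath_belast (path_cycle_adj_next Uxp yp xy) sA.
apply: (cardT (y :: p)); first by case/andP: Uxp.
exact: path_pred_behead (path_cycle_adj_prev Uxp yp xy) sA.
Qed.

End SpanningOrder.

Lemma next_last (T : eqType) (x : T) p :
  uniq (x :: p) -> next (x :: p) (last x p) = x.
Proof.
by move=> Uxp; rewrite next_nth mem_last index_last // nth_default.
Qed.

Lemma path_next (T : eqType) (e : rel T) x p y :
  path e x p -> y \in x :: p -> y != last x p -> e y (next (x :: p) y).
Proof.
move=> xp yp yl.
(* Relaxing [e] at the last vertex alone closes the path into a cycle. *)
pose e' := [rel u v | e u v || (u == last x p)].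
have : cycle e' (x :: p).
  rewrite /= rcons_path /= eqxx orbT andbT.
  by apply: sub_path xp => u v /= ->.
by move/next_cycle => /(_ _ yp) /=; rewrite (negPf yl) orbF.
Qed.

(** * Obstructions from a set [B] with all its neighbours in [A] *)

Section IsolatedSide.
Variables (V : finType) (G : sgraph V) (A B : {set V}).
Hypotheses (dAB : [disjoint A & B]) (AB0 : A :|: B != set0).
Hypotheses (ABT : A :|: B != setT).
Hypothesis GB : forall x y, x \in B -> G x y -> y \in A.

Lemma hamilton_cycle_card c : hamilton_cycle G c ->
  #|B| + #|[set x in A | next c x \in A]| < #|A|.
Proof.
case=> _ /andP[Gc Uc] cV.
have := card_isolated_side Uc cV (@edge_sym _ G) dAB AB0 ABT GB.
suff -> : [set x | ~~ G x (next c x)] = set0 by rewrite set0D cards0 addn0.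
by apply/setP => x; rewrite !inE (next_cycle Gc (cV x)).
Qed.

(** Only the closing step from [last x p] to [x] can fail to be an edge, and it costs nothing if it
    starts in [A]. *)
Lemma hamilton_path_card x p : hamilton_path G (x :: p) ->
  #|B| + #|[set y in A | next (x :: p) y \in A]| < #|A| + (last x p \notin A).
Proof.
case=> Up Gp pV.
apply: leq_trans (card_isolated_side Up pV (@edge_sym _ G) dAB AB0 ABT GB) _.
rewrite leq_add2l; set D := _ :\: A.
have DL : D \subset [set last x p] :\: A.
  apply: setSD; apply/subsetP => y; rewrite !inE; apply: contraR.
  exact: path_next.
apply: leq_trans (subset_leq_card DL) _; case: (boolP (last x p \in A)) => lA.
  by rewrite (eqP (_ : _ :\: A == set0)) ?cards0 // setD_eq0 sub1set.
by apply: leq_trans (subset_leq_card (subsetDl _ _)) _; rewrite cards1.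
Qed.

Lemma not_hamiltonian_side : #|A| <= #|B| -> ~ hamiltonian G.
Proof.
move=> leAB [c /hamilton_cycle_card]; rewrite ltnNge => /negP[].
exact: leq_trans (leq_addr _ _).
Qed.

Lemma not_traceable_side : #|A| < #|B| -> ~ traceable G.
Proof.
move=> ltAB [[[_ _ V0]|x p Hp]].
  by case/set0Pn: AB0 => y; have := V0 y.
by have := hamilton_path_card Hp; case: (_ \notin A) => /=; lia.
Qed.

(** With both ends chosen in [A], the closing step counts on the left and is free on the right. *)
Lemma not_hamiltonian_connected_side :
  1 < #|A| -> #|A| <= #|B|.+1 -> ~ hamiltonian_connected G.
Proof.
case/card_gt1P => x [y [xA yA xy]] leAB /(_ x y xy)[p [Hp lp]].
have [Up _ _] := Hp.
have := hamilton_path_card Hp; rewrite lp yA addn0.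
suff : 0 < #|[set z in A | next (x :: p) z \in A]| by lia.
by apply/card_gt0P; exists y; rewrite inE yA -lp next_last.
Qed.

Lemma not_k_edge_hamiltonian_side k :
  {in A &, forall x y, x != y -> G x y} ->
  k < #|A| -> #|A| <= #|B| + k -> ~ k_edge_hamiltonian G k.
Proof.
move=> GA kA leAB.
(* Any [k.+1] vertices of the clique [A] form a path with [k] edges, the forest to refute. *)
have /card_geqP[[|x p] [Up sp pA]] := kA; first by [].
case: sp => sp.
have Gp : sorted G (x :: p).
  apply: pairwise_sorted; move: Up; rewrite uniq_pairwise.
  by apply: sub_in_pairwise (allss _) => u v /pA uA /pA vA; apply: GA.
move=> /(_ [:: x :: p])[].
- by split; rewrite //= ?cats0 // [path _ _ _]Gp.
- by rewrite /forest_size big_seq1 /= sp.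
move=> c [Hc /andP[xp _]]; have [_ /andP[_ Uc] cV] := Hc.
have := hamilton_cycle_card Hc.
have := card_next_path Uc Up xp pA.
by rewrite sp; lia.
Qed.

End IsolatedSide.

(** Deleting [k] vertices of [A] keeps [B] intact and leaves at most [#|B|] vertices of [A], which
    rules out a Hamilton cycle. *)
Lemma not_k_hamiltonian_side (V : finType) (G : sgraph V) (A B : {set V}) k :
  [disjoint A & B] -> B != set0 -> A :|: B != setT ->
  (forall x y, x \in B -> G x y -> y \in A) ->
  k <= #|A| -> #|A| <= #|B| + k -> ~ k_hamiltonian G k.
Proof.
move=> dAB /set0Pn[b bB] ABT GB /card_geqP[s [Us ss sA]] leAB.
pose S := [set x in s].
have SA : S \subset A by apply/subsetP => x; rewrite inE => /sA.
have cS : #|S| = k by rewrite cardsE (card_uniqP Us).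
have BS x : x \in B -> x \notin S.
  by move=> xB; apply: contraL xB => /(subsetP SA) xA; rewrite (disjointFr dAB).
move=> /(_ S); rewrite cS leqnn => /(_ isT).
pose T : finType := {x : V | x \notin S}.
have val_card (X : {set V}) : #|[set x : T | val x \in X]| = #|X :\: S|.
  rewrite -(card_imset _ val_inj); apply: eq_card => x; rewrite inE.
  apply/imsetP/andP => [[y]|[xS xX]].
    by rewrite inE => yX ->; split=> //; exact: (valP y).
  by exists (Sub x xS); rewrite ?inE ?SubK.
apply: (@not_hamiltonian_side _ _ [set x | val x \in A] [set x | val x \in B]).
- rewrite disjoints_subset; apply/subsetP => x; rewrite !inE => xA.
  by rewrite (disjointFr dAB).
- by apply/set0Pn; exists (Sub b (BS b bB)); rewrite !inE SubK bB orbT.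
- apply: contra ABT => /eqP/setP AB'; apply/eqP/setP => x; rewrite !inE.
  have [xS|xS] := boolP (x \in S); first by rewrite (subsetP SA).
  by have := AB' (Sub x xS); rewrite !inE SubK.
- by move=> x y; rewrite !inE; apply: GB.
- rewrite !val_card !cardsD (setIidPr SA) cS.
  have -> : B :&: S = set0.
    by apply/setP => x; rewrite !inE; apply/andP => -[/BS]; rewrite inE => /negPf ->.
  by rewrite cards0; lia.
Qed.

(** * The graphs of the family *)

Local Open Scope ring_scope.

Theorem proposition4 (n i l : int)
  (hl1 : -1 <= l) (hl2 : l <= n - 3)
  (hi1 : 1 <= i) (hi2 : i%:Q <= (n - 1 - l)%:Q / 2)
  (G : sgraph (Gvertex n l i)) (hG : Gfamily G) :
  [/\ l = 0 -> ~ hamiltonian G,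
      l = -1 -> ~ traceable G,
      l = 1 -> ~ hamiltonian_connected G,
      forall k : nat, (1 <= k)%N -> k%:Z <= n - 3 -> l = k%:Z ->
        ~ k_edge_hamiltonian G k &
      forall k : nat, (1 <= k)%N -> k%:Z <= n - 3 -> l = k%:Z ->
        ~ k_hamiltonian G k].
Proof.
have {}hi2 : 2 * i <= n - 1 - l.
  by move: hi2; rewrite ler_pdivlMr // -(ler_int rat) rmorphM /= mulrC.
case: hG => subG keptG.
pose A : {set Gvertex n l i} := inl @: setT.
pose B : {set Gvertex n l i} := [set inr (inl b) | b in setT].
have cA : #|A| = absz (i + l) by rewrite card_imset ?cardsT ?card_ord // => ? ? [].
have cB : #|B| = absz i by rewrite card_imset ?cardsT ?card_ord // => ? ? [].
have memA x : (x \in A) = if x is inl _ then true else false.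
  apply/imsetP; case: x => [a|x]; first by exists a.
  by case.
have memB x : (x \in B) = if x is inr (inl _) then true else false.
  apply/imsetP; case: x => [a|[b|x]]; [by case | by exists b | by case].
have dAB : [disjoint A & B].
  by rewrite disjoints_subset; apply/subsetP => -[a|[b|x]]; rewrite inE memA memB.
have B0 : B != set0 by rewrite -card_gt0 cB; lia.
have AB0 : A :|: B != set0.
  by case/set0Pn: B0 => b bB; apply/set0Pn; exists b; rewrite inE bB orbT.
(* The bound on [i] leaves a vertex in the last clique, which lies outside [A :|: B]. *)
have C0 : (0 < absz (n - 2 * i - l)%R)%N by lia.
have ABT : A :|: B != setT.
  apply/eqP => /setP/(_ (inr (inr (Ordinal C0)))).
  by rewrite !inE memA memB.
have GB x y : x \in B -> G x y -> y \in A.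
  by rewrite memA memB; case: x => [|[b|]] // _ /subG; case: y => [|[]].
(* Missing edges have both ends in the last clique, so [A] remains a clique in [G]. *)
have GA : {in A &, forall x y, x != y -> G x y}.
  move=> [a|?] [a'|?]; rewrite !memA //= => _ _ aa'.
  have aG : Ggraph n l i (inl a) (inl a') by apply: contra aa' => /eqP ->.
  by case: (boolP (G _ _)) => // /(keptG _ _ aG)[? [? []]].
(* All cases rest on [#|A|] exceeding [#|B|] by [l]; the strict lower bounds on [#|A|] come from
   [1 <= i]. *)
split=> [l0|l0|l0|k k0 _ lk|k k0 _ lk].
- by apply: (not_hamiltonian_side dAB AB0 ABT GB); rewrite cA ?cB; lia.
- by apply: (not_traceable_side dAB AB0 ABT GB); rewrite cA ?cB; lia.
- by apply: (not_hamiltonian_connected_side dAB AB0 ABT GB); rewrite cA ?cB; lia.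
- by apply: (not_k_edge_hamiltonian_side dAB AB0 ABT GB GA); rewrite cA ?cB; lia.
- by apply: (not_k_hamiltonian_side dAB B0 ABT GB); rewrite cA ?cB; lia.
Qed.
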